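(* For positive integers $d \le n$, let $J(n,d)$ denote the maximal diameter among all $d$-dimensional subset partition graphs on $n$ symbols which satisfy the dimension reduction property. Then $J(n,d) \leq n^{1+\log_2 d}$.
   Context: Subset partition graph: Let $S$ be a finite set of cardinality $n$ (the symbol set; its elements are called symbols), and let $\mathcal{A} \subseteq \binom{S}{d}$ be a set of $d$-element subsets of $S$. Let $G = (\mathcal{V},E)$ be a connected graph with vertex set $\mathcal{V} = \{\mathcal{V}_0,\ldots,\mathcal{V}_t\}$, where $\mathcal{V}$ is a partition of $\mathcal{A}$, i.e. (1) $\mathcal{A} = \mathcal{V}_0 \cup \cdots \cup \mathcal{V}_t$, (2) $\mathcal{V}_i \cap \mathcal{V}_j = \emptyset$ if $i \neq j$, and (3) $\mathcal{V}_i \neq \emptyset$ for all $i$. Then $G$ is called a $d$-dimensional subset partition graph of $\mathcal{A}$ on the symbol set $S$ (on $n = |S|$ symbols). Its diameter is the diameter of the graph $G$ (the maximum over pairs of vertices in $\mathcal{V}$ of their graph distance). Restriction: For $F \subseteq S$, the restriction $G_F = (\mathcal{V}_F, E_F)$ is defined as follows. Let $\mathcal{A}_F := \{A \in \mathcal{A} : F \subseteq A\}$. Delete from each $\mathcal{V}_i$ every $d$-set that does not contain $F$. The vertex set $\mathcal{V}_F$ consists of those vertices that are still non-empty after this deletion, and two vertices in $\mathcal{V}_F$ are connected by an edge in $E_F$ exactly when the associated vertices were connected by an edge in $E$. Dimension reduction property: for every $F \subseteq S$ with $|F| \leq d$, the (underlying graph of the) restriction $G_F$ is a connected graph. Here the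 empty graph (when no $A \in \mathcal{A}$ contains $F$) is regarded as connected. *)

(* Defs.v *)
From mathcomp Require Import all_boot.
From mathcomp Require classical_sets.

Set Implicit Arguments.
Unset Strict Implicit.
Unset Printing Implicit Defensive.

(* A finite simple graph is a vertex set V : {set T} together with a set E of
   two-element subsets of V. *)
Section Graph.
Variable T : finType.
Implicit Types (V : {set T}) (E : {set {set T}}) (x y : T).

Definition adj E : rel T := fun x y => [set x; y] \in E.

(* The empty graph is connected under this definition. *)
Definition graph_connected V E : Prop :=
  forall x y, x \in V -> y \in V -> connect (adj E) x y.

(* Least length of a walk from x to y, with the default value #|T| when there
   is none; a shortest walk visits at most #|T| vertices, so its length is
   smaller than #|T|. *)
Definition gdist E x y : nat :=
  find (fun k => [exists p : k.-tuple T, path (adj E) x p && (last x p == y)])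
       (iota 0 #|T|).

Definition graph_diameter V E : nat :=
  \max_(x in V) \max_(y in V) gdist E x y.

Lemma gdist_le_card E x y : gdist E x y <= #|T|.
Proof. by rewrite -[X in _ <= X](size_iota 0) find_size. Qed.

Lemma gdist_min E x p : path (adj E) x p -> gdist E x (last x p) <= size p.
Proof.
move=> xp; rewrite leqNgt; apply/negP => lt_p.
have lt_pT := leq_trans lt_p (gdist_le_card E x (last x p)).
have /negbT/negP := before_find 0 lt_p; rewrite nth_iota // add0n; apply.
by apply/existsP; exists (in_tuple p); rewrite xp eqxx.
Qed.

Lemma gdist_attained E x y : connect (adj E) x y ->
  exists p, [/\ path (adj E) x p, last x p = y & size p = gdist E x y].
Proof.
case/connectP => p0 /shortenP[p xp Up _] ->.
have lt_pT : size p < #|T|.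
  by rewrite -[_.+1]/(size (x :: p)) -(card_uniqP Up) max_card.
have lt_d : gdist E x (last x p) < #|T| := leq_ltn_trans (gdist_min xp) lt_pT.
have := lt_d; rewrite -[X in _ < X](size_iota 0) -has_find => /(nth_find 0).
rewrite nth_iota // add0n => /existsP[q /andP[xq /eqP lq]].
by exists q; split; rewrite ?size_tuple.
Qed.

End Graph.

(* The vertices are subsets of [dsets]; since they are nonempty and
   pairwise disjoint, an enumeration V_0, ..., V_t has no repetition and the
   vertex set can be given as a set of sets. It is nonempty since t >= 0. *)
Record subset_partition_graph (S : finType) (d : nat) := SubsetPartitionGraph {
  dsets : {set {set S}};
  vertices : {set {set {set S}}};
  edges : {set {set {set {set S}}}};
  dsets_card : forall A, A \in dsets -> #|A| = d;
  vertices_partition : partition vertices dsets;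
  vertices_neq0 : vertices != set0;
  edges_pairs : forall e, e \in edges -> e \subset vertices /\ #|e| = 2;
  spg_connected : graph_connected vertices edges
}.

Section SubsetPartitionGraph.
Variables (S : finType) (d : nat).
Implicit Types (G : subset_partition_graph S d) (F : {set S}).

Definition diameter G : nat := graph_diameter (vertices G) (edges G).

Definition restr_dsets G F : {set {set S}} :=
  [set A in dsets G | F \subset A].

Definition restr_vertices G F : {set {set {set S}}} :=
  [set V :&: restr_dsets G F | V in vertices G] :\ set0.

(* An edge {V, W} survives as {V :&: A_F, W :&: A_F} when both of these are
   nonempty. *)
Definition restr_edges G F : {set {set {set {set S}}}} :=
  [set [set V :&: restr_dsets G F | V in (e : {set {set {set S}}})]
    | e in edges G & [forall V in e, V :&: restr_dsets G F != set0]].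

Definition dimension_reduction G : Prop :=
  forall F, #|F| <= d ->
    graph_connected (restr_vertices G F) (restr_edges G F).

End SubsetPartitionGraph.

Definition spg_diameter (n d m : nat) : Prop :=
  exists (S : finType) (G : subset_partition_graph S d),
    [/\ #|S| = n, dimension_reduction G & diameter G = m].

Definition is_max_diameter (n d m : nat) : Prop :=
  spg_diameter n d m /\ forall m', spg_diameter n d m' -> m' <= m.

(* [xget] picks an element satisfying the predicate; one exists when d <= n,
   see [JP]. *)
Definition J (n d : nat) : nat := classical_sets.xget 0 (is_max_diameter n d).

Lemma spg_diameter_bound n d m : spg_diameter n d m -> m <= 2 ^ (2 ^ n).
Proof.
case=> S [G [<- _ <-]].
have card_sets (U : finType) : #|{: {set U}}| = 2 ^ #|U|.
  by rewrite -[in RHS]cardsT -card_powerset powersetT cardsT.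
rewrite -!card_sets.
by apply/bigmax_leqP => x _; apply/bigmax_leqP => y _; apply: gdist_le_card.
Qed.

Lemma spg_diameter_ex n d : d <= n -> exists m, spg_diameter n d m.
Proof.
move=> le_dn.
have [A /eqP cA] : exists A : {set 'I_n}, #|A| == d.
  have : 0 < #|[set A : {set 'I_n} | #|A| == d]|.
    by rewrite card_draws card_ord bin_gt0.
  by case/card_gt0P => A; rewrite inE; exists A.
pose fam : {set {set 'I_n}} := [set A].
pose V : {set {set {set 'I_n}}} := [set fam].
have c1 : forall B, B \in fam -> #|B| = d by move=> B /set1P->.
have c2 : partition V fam.
  apply/and3P; split; first by rewrite /cover big_set1.
    by apply/trivIsetP => X Y /set1P-> /set1P->; rewrite eqxx.
  by rewrite inE eq_sym; apply/set0Pn; exists A; rewrite inE.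
have c3 : V != set0 by apply/set0Pn; exists fam; rewrite inE.
have c4 (e : {set {set {set 'I_n}}}) : e \in set0 -> e \subset V /\ #|e| = 2.
  by rewrite inE.
have c5 : graph_connected V set0 by move=> x y /set1P-> /set1P->.
pose G := SubsetPartitionGraph c1 c2 c3 c4 c5.
exists (diameter G), 'I_n, G; split=> //; first exact: card_ord.
move=> F _ x y; rewrite !inE => /andP[_ /imsetP[X /set1P-> ->]].
by case/andP=> _ /imsetP[Y /set1P-> ->].
Qed.

Lemma JP n d : d <= n -> is_max_diameter n d (J n d).
Proof.
move=> le_dn; apply: (@classical_sets.xgetPex _ _ (is_max_diameter n d)).
have [m0 hm0] := spg_diameter_ex le_dn.
have asP m := @boolp.asboolP (spg_diameter n d m).
have ex : exists m, boolp.asbool (spg_diameter n d m).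
  by exists m0; apply/asP.
have ub m : boolp.asbool (spg_diameter n d m) -> m <= 2 ^ (2 ^ n).
  by move/asP; apply: spg_diameter_bound.
case: (ex_maxnP ex ub) => m /asP hm mx.
by exists m; split=> // m' /asP; apply: mx.
Qed.

(* Main.v *)
Require Import Defs.
From mathcomp Require Import all_boot all_order all_algebra.
From mathcomp Require Import zify lra.
From mathcomp Require Import reals exp.

(** Let u be an endpoint of a diameter, and layer the d-sets by the distance
    of their block from u. By dimension reduction, the layers meeting the family
    of d-sets that contain a given F form an interval. Let N(d,n) bound the number
    of layers of any family of d-sets with this property involving at most n
    symbols. A comparison of the lowest and highest layers gives the
    Kalai-Kleitman type recurrence
      N(d+1,n) <= 2 N(d+1, n/2) + N(d, n-1),
    and N(1,n) <= n, whence N(d,n) <= n^(1 + log2 d). *)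

Set Implicit Arguments.
Unset Strict Implicit.
Unset Printing Implicit Defensive.

(** * Width of convex layerings and its recurrence *)

Section Layerings.
Variable S : finType.
Implicit Types (A : {set {set S}}) (F X Y Z : {set S}) (l : {set S} -> nat).

Definition convex_layering A l : Prop :=
  forall F X Y j, X \in A -> Y \in A -> F \subset X -> F \subset Y ->
    l X <= j <= l Y -> exists2 Z, Z \in A & F \subset Z /\ l Z = j.

(** Symbols are counted in [cover A], so that [n] can shrink over a fixed [S]. The strict inequality
    counts layers: [N = 0] forces [A] to be empty. *)
Definition width_bound (d n N : nat) : Prop :=
  forall A l, (forall X, X \in A -> #|X| = d) -> #|cover A| <= n ->
    convex_layering A l -> forall X Y, X \in A -> Y \in A -> l Y < l X + N.

Lemma sub_cover A (B : {set {set S}}) : A \subset B -> cover A \subset cover B.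
Proof.
move=> /subsetP AB; apply/bigcupsP => X XA.
exact/bigcup_sup/AB.
Qed.

Lemma convex_layering_interval A l a b : convex_layering A l ->
  convex_layering [set X in A | a <= l X <= b] l.
Proof.
move=> cA F X Y j; rewrite !inE => /andP[XA lX] /andP[YA lY] FX FY lj.
have [Z ZA [FZ lZ]] := cA F X Y j XA YA FX FY lj.
by exists Z; rewrite // inE ZA lZ; lia.
Qed.

(** This is the link of [s] in the simplicial complex with facets [A]. *)
Definition link A (s : S) : {set {set S}} := [set X :\ s | X in A & s \in X].

Lemma linkP A s X : reflect (s |: X \in A /\ s \notin X) (X \in link A s).
Proof.
apply: (iffP imsetP) => [[Y]|[sXA sX]].
  by rewrite inE => /andP[YA sY] ->; rewrite setD1K // !inE eqxx.
by exists (s |: X); rewrite ?inE ?sXA ?eqxx //= setU1K.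
Qed.

Lemma cover_link A s : cover (link A s) \subset cover A :\ s.
Proof.
apply/bigcupsP => X /linkP[sXA sX]; rewrite subsetD1 sX andbT.
by apply: subset_trans (subsetUr [set s] X) _; apply: bigcup_sup sXA.
Qed.

(** Convexity of [A] is applied to [s |: F]; the set found contains [s], and removing [s] puts it in
    the link. *)
Lemma convex_layering_link A l s : convex_layering A l ->
  convex_layering (link A s) (fun X => l (s |: X)).
Proof.
move=> cA F X Y j /linkP[XA sX] /linkP[YA sY] FX FY lj.
have [Z ZA [FZ lZ]] := cA (s |: F) _ _ j XA YA (setUS _ FX) (setUS _ FY) lj.
have sZ : s \in Z by apply: (subsetP FZ); rewrite setU11.
exists (Z :\ s); first by apply/linkP; rewrite setD1K // !inE eqxx.
split; last by rewrite setD1K.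
rewrite subsetD1 (subset_trans (subsetUr _ _) FZ) /=.
by apply/negP => /(subsetP FX); apply/negP.
Qed.

Lemma width_bound_0 d : 0 < d -> width_bound d 0 0.
Proof.
move=> d_gt0 A l Ad; rewrite leqn0 cards_eq0 => /eqP cA0 _ X Y XA.
suff: #|X| <= 0 by rewrite Ad // leqNgt d_gt0.
by rewrite leqn0 cards_eq0 -subset0 -cA0 (bigcup_sup _ XA).
Qed.

(** There are at most [n] singletons, and convexity for the empty set makes every value from [l X]
    to [l Y] occur on one of them. *)
Lemma width_bound_1 n : width_bound 1 n n.
Proof.
move=> A l A1 cAn cA X Y XA YA.
have [ltYX|leXY] := ltnP (l Y) (l X); first exact: ltn_addr.
have leAn : #|A| <= n.
  apply: leq_trans cAn; apply: leq_trans (leq_imset_card set1 (cover A)).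
  apply/subset_leq_card/subsetP => Z ZA.
  have /eqP/cards1P[x Zx] := A1 Z ZA; apply/imsetP; exists x => //.
  by apply/bigcupP; exists Z; rewrite // Zx inE.
suff: size (iota (l X) (l Y - l X).+1) <= size [seq l Z | Z <- enum A].
  by rewrite size_iota size_map -cardE => /leq_trans/(_ leAn); lia.
apply: uniq_leq_size (iota_uniq _ _) _ => j; rewrite mem_iota => lj.
have [|Z ZA [_ <-]] := cA set0 X Y j XA YA (sub0set _) (sub0set _); first by lia.
by rewrite map_f // mem_enum.
Qed.

(* The p + 1 lowest and the p + 1 highest of the layers between X and Y each
   involve more than n / 2 symbols, so they share a symbol s; by convexity s
   occurs in every layer in between, and the link of s bounds their number. *)
Lemma width_bound_step d n p q :
  width_bound d.+1 n./2 p -> width_bound d n.-1 q ->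
  width_bound d.+1 n (2 * p + q).
Proof.
move=> Hp Hq A l Ad cAn cA X Y XA YA.
(* From here on [l X + p <= l Y - p], so the two end windows share at most one layer. *)
have [|ge_p] := ltnP (l Y) (l X + 2 * p); first by lia.
(* On at most [n./2] symbols, [Hp] would forbid the layers [a] and [a + p] from both being
   attained. *)
have large a : l X <= a -> a + p <= l Y ->
    n./2 < #|cover [set Z in A | a <= l Z <= a + p]|.
  move=> Xa aY; rewrite ltnNge; apply/negP => small.
  have layer j : l X <= j <= l Y -> exists2 Z, Z \in A & l Z = j.
    move=> lj; have [Z ZA [_ lZ]] := cA set0 X Y j XA YA (sub0set _) (sub0set _) lj.
    by exists Z.
  have [|Z1 Z1A lZ1] := layer a; first by lia.
  have [|Z2 Z2A lZ2] := layer (a + p); first by lia.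
  have Bd Z : Z \in [set Z in A | a <= l Z <= a + p] -> #|Z| = d.+1.
    by rewrite inE => /andP[/Ad].
  have := Hp _ _ Bd small (convex_layering_interval cA) Z1 Z2.
  by rewrite !inE Z1A Z2A lZ1 lZ2 ltnn; lia.
have [s] : exists s, s \in cover [set Z in A | l X <= l Z <= l X + p]
    :&: cover [set Z in A | l Y - p <= l Z <= l Y - p + p].
  apply/set0Pn; rewrite -card_gt0.
  have := cardsUI (cover [set Z in A | l X <= l Z <= l X + p])
                  (cover [set Z in A | l Y - p <= l Z <= l Y - p + p]).
  have := large (l X); have := large (l Y - p).
  have subA a b : cover [set Z in A | a <= l Z <= b] \subset cover A.
    by apply: sub_cover; apply/subsetP => Z; rewrite inE => /andP[].
  have : #|cover [set Z in A | l X <= l Z <= l X + p]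
    :|: cover [set Z in A | l Y - p <= l Z <= l Y - p + p]| <= n.
    by apply: leq_trans cAn; apply: subset_leq_card; rewrite subUset !subA.
  by lia.
rewrite inE => /andP[/bigcupP[Z1 + sZ1] /bigcupP[Z2 + sZ2]].
rewrite !inE => /andP[Z1A lZ1] /andP[Z2A lZ2].
(* [Z1] may lie as high as [l X + p] and [Z2] as low as [l Y - p], so only the layers between these
   are sure to contain [s]. *)
have layer j : l X + p <= j <= l Y - p -> exists2 Z, Z \in A & s \in Z /\ l Z = j.
  rewrite -!sub1set in sZ1 sZ2; move=> lj.
  have [|Z ZA [sZ lZ]] := cA [set s] Z1 Z2 j Z1A Z2A sZ1 sZ2; first by lia.
  by exists Z; rewrite // -sub1set.
have [|W1 W1A [sW1 lW1]] := layer (l X + p); first by lia.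
have [|W2 W2A [sW2 lW2]] := layer (l Y - p); first by lia.
have Ld Z : Z \in link A s -> #|Z| = d.
  by case/linkP => /Ad + sZ; rewrite cardsU1 sZ => -[].
have Ln : #|cover (link A s)| <= n.-1.
  apply: leq_trans (subset_leq_card (cover_link A s)) _.
  have sA : s \in cover A by apply/bigcupP; exists W1.
  by move: cAn; rewrite (cardsD1 s) sA; lia.
(* This gives [l Y - p < l X + p + q]. *)
have := Hq _ _ Ld Ln (convex_layering_link cA) (W1 :\ s) (W2 :\ s).
by rewrite !setD1K // lW1 lW2 !(introT (linkP _ _ _)) ?setD1K ?inE ?eqxx //; lia.
Qed.

End Layerings.

(** * Distance from a block as a convex layering *)

Lemma gdist_refl (T : finType) (E : {set {set T}}) x : gdist E x x = 0.
Proof. by apply/eqP; rewrite -leqn0 (@gdist_min _ E x [::]). Qed.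

Lemma gdist_step (T : finType) (E : {set {set T}}) x y z :
  connect (adj E) x y -> adj E y z -> gdist E x z <= (gdist E x y).+1.
Proof.
move=> /gdist_attained[p [xp <- <-]] yz.
rewrite -(size_rcons p z) -{1}(last_rcons x p z); apply: gdist_min.
by rewrite rcons_path xp.
Qed.

Section DistanceLayering.
Variables (S : finType) (d : nat) (G : subset_partition_graph S d).
Variable u : {set {set S}}.
Hypothesis uV : u \in vertices G.

Definition dist_layer (X : {set S}) : nat :=
  gdist (edges G) u (pblock (vertices G) X).

Lemma dist_layerE V X : V \in vertices G -> X \in V ->
  dist_layer X = gdist (edges G) u V.
Proof.
move=> VG XV; have /and3P[_ tG _] := vertices_partition G.
by rewrite /dist_layer (def_pblock tG VG XV).
Qed.

Lemma dist_layer_edge e V W X Y : e \in edges G -> V \in e -> W \in e ->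
  X \in V -> Y \in W -> dist_layer Y <= (dist_layer X).+1.
Proof.
move=> eG Ve We XV YW; have [/subsetP eV e2] := edges_pairs eG.
rewrite (dist_layerE (eV _ Ve) XV) (dist_layerE (eV _ We) YW).
have [->|VW] := eqVneq V W; first exact: leqnSn.
apply: gdist_step; first exact: spg_connected (eV _ Ve).
rewrite /adj; suff <- : e = [set V; W] by [].
apply/esym/eqP; rewrite eqEcard e2 cards2 VW andbT.
by apply/subsetP => Z /set2P[]->.
Qed.

Lemma restr_edgesP F x y : adj (restr_edges G F) x y ->
  exists e V W, [/\ e \in edges G, V \in e, W \in e,
    x = V :&: restr_dsets G F & y = W :&: restr_dsets G F] /\ y != set0.
Proof.
case/imsetP => e; rewrite inE => /andP[eG /forall_inP ne0] exy.
have : y \in [set x; y] by rewrite set22.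
have : x \in [set x; y] by rewrite set21.
rewrite exy => /imsetP[V Ve xV] /imsetP[W We yW].
by exists e, V, W; split=> //; rewrite yW ne0.
Qed.

(** A discrete intermediate value argument: the layer is constant on a block and rises by at most
    one along an edge, so a path in the restriction cannot skip [j]. *)
Lemma dist_layer_path F x p X Y j :
    x \in restr_vertices G F -> path (adj (restr_edges G F)) x p ->
    X \in x -> Y \in last x p -> dist_layer X <= j <= dist_layer Y ->
  exists2 Z, Z \in dsets G & F \subset Z /\ dist_layer Z = j.
Proof.
elim: p x X => [|y p IH] x X xF /= => [_ | /andP[xy yp]] Xx Yl lj.
  have /setD1P[_ /imsetP[V VG xV]] := xF.
  move: Xx Yl; rewrite xV => /setIP[XV]; rewrite inE => /andP[XG FX] /setIP[YV _].
  exists X => //; split=> //; move: lj.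
  by rewrite !(dist_layerE VG) //; lia.
have [e [V [W [[eG Ve We xV yW] y0]]]] := restr_edgesP xy.
have := Xx; rewrite xV inE => /andP[XV]; rewrite inE => /andP[XG FX].
have [lX|lX] := eqVneq (dist_layer X) j; first by exists X.
have /set0Pn[X1 X1y] := y0.
have yF : y \in restr_vertices G F.
  have [/subsetP eV _] := edges_pairs eG; rewrite in_setD1 y0 /= yW.
  by apply: (imset_f (fun V => V :&: restr_dsets G F)); apply: eV.
have X1W : X1 \in W by move: X1y; rewrite yW => /setIP[].
apply: (IH y X1 yF yp X1y Yl).
have /andP[lXj ->] := lj; rewrite andbT.
apply: leq_trans (dist_layer_edge eG Ve We XV X1W) _.
by rewrite ltn_neqAle lX.
Qed.

Lemma dist_layer_convex : dimension_reduction G ->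
  convex_layering (dsets G) dist_layer.
Proof.
move=> dimG F X Y j XG YG FX FY lj.
(* Lying inside a [d]-set, [F] is small enough for dimension reduction. *)
have Fd : #|F| <= d by rewrite -(dsets_card XG) subset_leq_card.
have /and3P[/eqP cG _ _] := vertices_partition G.
have block Z : Z \in dsets G -> F \subset Z ->
    exists2 z, z \in restr_vertices G F & Z \in z.
  move=> ZG FZ; have Zz : Z \in pblock (vertices G) Z :&: restr_dsets G F.
    by rewrite in_setI mem_pblock cG ZG inE ZG FZ.
  exists (pblock (vertices G) Z :&: restr_dsets G F) => //.
  rewrite in_setD1; apply/andP; split; first by apply/set0Pn; exists Z.
  apply: (imset_f (fun V => V :&: restr_dsets G F)).
  by rewrite pblock_mem ?cG.
have [[x xF Xx] [y yF Yy]] := (block X XG FX, block Y YG FY).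
have /connectP[p xp yl] := dimG F Fd x y xF yF.
by apply: (dist_layer_path xF xp Xx) lj; rewrite -yl.
Qed.

End DistanceLayering.

(** Layering by distance from [u] puts [u] in layer 0 and any block [v] in layer [gdist u v]. *)
Lemma diameter_le_width (S : finType) (d N : nat)
    (G : subset_partition_graph S d) :
  width_bound S d #|S| N -> dimension_reduction G -> diameter G <= N.
Proof.
move=> wN dimG; apply/bigmax_leqP => u uG; apply/bigmax_leqP => v vG.
have /and3P[/eqP cG _ /negP nG] := vertices_partition G.
have pt w : w \in vertices G -> exists2 X, X \in w & X \in dsets G.
  move=> wG; have [w0|/set0Pn[X Xw]] := eqVneq w set0; first by rewrite w0 in wG.
  by exists X; rewrite // -cG; apply/bigcupP; exists w.
have [[X Xu XG] [Y Yv YG]] := (pt u uG, pt v vG).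
have := wN _ _ (@dsets_card _ _ G) (max_card _) (dist_layer_convex uG dimG) X Y XG YG.
by rewrite (dist_layerE u uG Xu) (dist_layerE u vG Yv) gdist_refl => /ltnW.
Qed.

(** * Solving the recurrence with real powers *)

Import Order.TTheory GRing.Theory Num.Theory.
Local Open Scope ring_scope.

Section Estimate.
Variable R : realType.
Implicit Types (x y : R).

Lemma ln2_gt0 : 0 < ln 2 :> R.
Proof. by rewrite ln_gt0 // ltr1n. Qed.

Lemma powR2_log x : 0 < x -> 2 `^ (ln x / ln 2) = x :> R.
Proof.
by move=> x0; rewrite /powR pnatr_eq0 /= divfK ?gt_eqF ?ln2_gt0 ?lnK.
Qed.

Lemma log2_ge0 x : 1 <= x -> 0 <= ln x / ln 2 :> R.
Proof. by move=> x1; rewrite divr_ge0 ?ln_ge0 ?ler1n. Qed.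

(** Here [x] stands for the dimension and [y] for the number of symbols. The two terms on the left
    are at most [x / (x + 1)] and exactly [1 / (x + 1)] of the right side. *)
Lemma powR_recurrence x y : 1 <= x -> 2 <= y ->
  y `^ (1 + ln x / ln 2) + 2 * (y / 2) `^ (1 + ln (x + 1) / ln 2)
    <= y `^ (1 + ln (x + 1) / ln 2).
Proof.
move=> x1 y2; have x0 : 0 < x by apply: lt_le_trans x1.
have y0 : 0 < y by apply: lt_le_trans y2.
set a := ln x / ln 2; set b := ln (x + 1) / ln 2.
have b2 : 2 `^ (1 + b) = 2 * (x + 1) :> R.
  by rewrite powRD ?pnatr_eq0 ?implybT // powRr1 // powR2_log // addr_gt0.
have ab : a <= b.
  by rewrite ler_pM2r ?invr_gt0 ?ln2_gt0 // ler_ln ?posrE //; lra.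
(* Since [y >= 2], the factor [y] to the power [b - a] is at least 2 to that power, which is
   [(x + 1) / x]. *)
have big : (x + 1) * y `^ (1 + a) <= x * y `^ (1 + b).
  have -> : 1 + b = 1 + a + (b - a) by lra.
  rewrite [y `^ (_ + (b - a))]powRD ?(gt_eqF y0) ?implybT //.
  rewrite mulrCA [leLHS]mulrC ler_pM2l ?powR_gt0 //.
  have -> : x + 1 = x * 2 `^ (b - a) :> R.
    rewrite -[X in X * _](powR2_log x0) -powRD ?pnatr_eq0 ?implybT //.
    by rewrite [_ + (b - a)]addrC subrK powR2_log // addr_gt0.
  by rewrite ler_pM2l // ge0_ler_powR ?nnegrE ?subr_ge0 // ltW.
have half : 2 * (x + 1) * (y / 2) `^ (1 + b) = y `^ (1 + b).
  by rewrite -b2 -powRM ?divr_ge0 ?ltW // mulrC divfK ?pnatr_eq0.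
have : (x + 1) * (y `^ (1 + a) + 2 * (y / 2) `^ (1 + b)) <= (x + 1) * y `^ (1 + b).
  by rewrite mulrDr mulrA [(x + 1) * 2]mulrC half [leRHS]mulrDl mul1r lerD2r.
by rewrite ler_pM2l // addr_gt0.
Qed.

(** Induction on [d], with a strong induction on [n] inside because the recurrence halves [n] in the
    same dimension. *)
Lemma width_bound_powR (S : finType) n d : (0 < d)%N ->
  exists2 N, width_bound S d n N &
    N%:R <= n%:R `^ (1 + ln d%:R / ln 2) :> R.
Proof.
case: d => // d _; elim: d n => [|d IHd] n.
  exists n; first exact: width_bound_1.
  by rewrite ln1 mul0r addr0 powRr1.
(* The cases [n = 0] and [n = 1] are separate, as [powR_recurrence] needs [y >= 2]; for [n = 1] both
   smaller problems have no symbols. *)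
elim/ltn_ind: n => -[|[|n]] IHn.
- by exists 0%N; [exact: width_bound_0 | rewrite powR_ge0].
- exists 0%N; last by rewrite powR_ge0.
  by apply: (@width_bound_step _ _ 1 0 0); apply: width_bound_0.
have [|p Hp hp] := IHn n.+2./2; first by lia.
have [q Hq hq] := IHd n.+1; exists (2 * p + q)%N.
  exact: width_bound_step.
have nn : n.+2./2%:R <= n.+2%:R / 2 :> R.
  by rewrite ler_pdivlMr // -natrM ler_nat; lia.
have := @powR_recurrence d.+1%:R n.+2%:R.
rewrite ler1n ler_nat natr1 => /(_ isT isT).
(* Monotonicity of the power absorbs the predecessor and the rounding in [n.+2./2]. *)
apply: le_trans; rewrite natrD natrM addrC lerD ?ler_pM2l //.
  apply: le_trans hq _; apply: ge0_ler_powR; rewrite ?nnegrE ?ler_nat //.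
  by rewrite addr_ge0 // log2_ge0 // ler1n.
apply: le_trans hp _; apply: ge0_ler_powR; rewrite ?nnegrE ?divr_ge0 //.
by rewrite addr_ge0 // log2_ge0 // ler1n.
Qed.

End Estimate.

Theorem theorem4p2 (R : realType) (n d : nat) (hd : (0 < d)%N) (hdn : (d <= n)%N) :
  ((J n d)%:R <= n%:R `^ (1 + ln d%:R / ln 2%:R) :> R)%R.
Proof.
have [[S [G [<- dimG <-]]] _] := JP hdn.
have [N wN leN] := width_bound_powR R S #|S| hd.
by apply: le_trans leN; rewrite ler_nat (diameter_le_width wN).
Qed.
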